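(* Let $G$ be a hyperbolic group, $n,m\ge 1$ integers, let $G_1,G_2,\dots,G_n,H_1,H_2,\dots,H_m$ be infinite maximal elementary subgroups of $G$, and let $f,e\in G$. Suppose $G_i\ne G_{i+1}$ for $i=1,\dots,n-1$ and $H_j\neq H_{j+1}$ for $j=1,\dots,m-1$. Then the sets $fG_1\cdots G_n$ and $eH_1\cdots H_m$ are equal if and only if $n=m$, $G_n=H_n$, and there exist elements $z_j\in H_j$, $j=1,\dots,n$, such that $$G_j=(z_nz_{n-1}\cdots z_{j+1})\cdot H_j\cdot(z_nz_{n-1}\cdots z_{j+1})^{-1},\quad j=1,2,\dots,n-1,$$ and $f=ez_1^{-1}z_2^{-1}\cdots z_n^{-1}$.
   Context: A group is elementary if it has a cyclic subgroup of finite index. A maximal elementary subgroup of $G$ is an elementary subgroup not properly contained in another elementary subgroup of $G$. Products of subsets are $AB=\{ab\mid a\in A,b\in B\}$. *)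

(* Defs.v *)
From mathcomp Require Import all_boot all_order all_algebra.
From mathcomp Require Import all_classical.

Set Implicit Arguments.
Unset Strict Implicit.
Unset Printing Implicit Defensive.

Local Open Scope classical_set_scope.
Local Open Scope group_scope.

Section WordMetric.
Variables (G : groupType) (S : seq G).

Definition spelled (g : G) (n : nat) : bool :=
  `[< exists w : seq G,
        [/\ all (fun s => (s \in S) || (s^-1 \in S)) w,
            \prod_(s <- w) s = g & size w = n] >].

Definition generates : Prop := forall g : G, exists n : nat, spelled g n.

Hypothesis genS : generates.

Definition word_length (g : G) : nat := ex_minn (genS g).

Definition word_dist (x y : G) : nat := word_length (x^-1 * y).

Definition gromov_product (w x y : G) : rat :=
  (((word_dist x w)%:R + (word_dist y w)%:R - (word_dist x y)%:R) / 2%:R)%R.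

End WordMetric.

(* Gromov's four-point definition, applied to G with the word metric of some
   finite generating set, i.e. to the vertex set of a Cayley graph.  Passing to
   the geometric realization of the graph, or to real delta, only changes the
   value of delta. *)
Definition hyperbolic (G : groupType) : Prop :=
  exists (S : seq G) (genS : generates S) (delta : rat),
    forall w x y z : G,
      (Num.min (gromov_product genS w x y) (gromov_product genS w y z) - delta
         <= gromov_product genS w x z)%R.

Section Subsets.
Variable G : groupType.
Implicit Types (A B M : set G) (g : G).

Definition setmul A B : set G := [set a * b | a in A & b in B].

Definition conjugate_by g A : set G := [set g * a * g^-1 | a in A].

Definition subgroup A : Prop :=
  A 1 /\ forall x y, A x -> A y -> A (x * y^-1).

Definition cyclic_span g : set G :=
  [set x | exists k : nat, x = g ^+ k \/ x = g ^- k].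

Definition left_cosets A B : set (set G) := [set setmul [set x] B | x in A].

Definition elementary A : Prop :=
  subgroup A /\
  exists2 c : G, A c & finite_set (left_cosets A (cyclic_span c)).

Definition maximal_elementary M : Prop :=
  elementary M /\ forall E : set G, elementary E -> M `<=` E -> E = M.

(* The subset f A_1 A_2 ... A_n; the value A 0 is not used. *)
Definition translated_product (f : G) (A : nat -> set G) (n : nat) : set G :=
  setmul [set f] (\big[setmul/[set 1]]_(1 <= i < n.+1) A i).

(* z_n z_(n-1) ... z_(j+1), with decreasing indices; it is 1 if n <= j. *)
Definition descending_product (z : nat -> G) (n j : nat) : G :=
  \prod_(i <- rev (index_iota j.+1 n.+1)) z i.

End Subsets.

(* Main.v *)
Require Import Defs.
From mathcomp Require Import all_boot all_order all_algebra.
From mathcomp Require Import all_classical.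
From mathcomp Require Import zify lra.

Set Implicit Arguments.
Unset Strict Implicit.
Unset Printing Implicit Defensive.

Import Order.TTheory GRing.Theory Num.Theory.

Local Open Scope classical_set_scope.
Local Open Scope group_scope.

(** Measure the group by its word length and write (x|y) for the Gromov product
at 1.  An element c of infinite order satisfies sup (c^-i | c^j) < oo: if no
conjugate h of a power of c satisfies |h^2| > |h| + 3 delta, then the midpoint m
of a long segment [1, c^M] is moved a bounded distance by c, ..., c^N for any N,
so two of the conjugates m^-1 c^i m coincide.  Hence the commensurator of c lies
near the powers of c, an infinite maximal elementary subgroup is such a
commensurator, and two of them are equal as soon as (a|b) is unbounded on them.

Therefore the broken path f, f g_1, ..., f g_1 ... g_n is close to a segment when
all g_i are long.  If f g_1 ... g_n = e h_1 ... h_m y for sequences with all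
factors tending to infinity, comparing the two paths vertex by vertex shows that
n = m and that, along a subsequence, u_i = (e h_1 ... h_i)^-1 (f g_1 ... g_i) is
constant.  Then H_i = u_(i-1) G_i u_(i-1)^-1 and u_i = z_i u_(i-1) with z_i in
H_i, and u_n = y.  When the h_i are arbitrary, bounded factors are absorbed and
equal neighbours merged; this loses at least one factor, so a product of n
subgroups contained in a product of m of them forces n <= m, and nothing is
absorbed when n = m. *)

(** * Subsequences *)

Lemma infinite_injection (T : Type) (A : set T) :
  infinite_set A -> exists2 u : nat -> T, injective u & forall k, A (u k).
Proof.
move=> /infiniteP /card_leP [f].
exists (fun k => val (f (SigSub (in_setT k)))) => [i j /val_inj|k].
  by move/(@inj _ _ _ f); rewrite !in_setT => /(_ isT isT) [].
exact: set_mem (valP _).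
Qed.

(** A subsequence is any injective reindexing, not necessarily increasing: composing with it keeps
    an injective sequence injective. *)
Lemma const_subsequence (T : Type) (x : nat -> T) :
  finite_set (range x) ->
  exists2 phi : nat -> nat, injective phi & forall k, x (phi k) = x (phi 0%N).
Proof.
move=> xfin.
have [v vinf] : exists v, infinite_set (x @^-1` [set v]).
  apply: contrapT => /forallNP xall; apply: infinite_nat.
  have := bigcup_finite xfin (fun v _ => contrapT (xall v)).
  by apply: sub_finite_set => k _; exists (x k) => //; exact: imageT.
have [phi pinj pv] := infinite_injection vinf.
by exists phi => // k; rewrite (pv k) (pv 0%N).
Qed.

Lemma finite_range_collision (T : Type) (x : nat -> T) :
  finite_set (range x) -> exists i j, (i < j)%N /\ x i = x j.
Proof.
move=> /const_subsequence [phi pinj pc].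
have : phi 0%N != phi 1%N by apply/eqP => /pinj.
rewrite neq_ltn => /orP[] lt; [exists (phi 0%N), (phi 1%N)|exists (phi 1%N), (phi 0%N)].
  by rewrite lt (pc 1%N).
by rewrite lt (pc 1%N).
Qed.

Lemma subsequence_dichotomy (T : Type) (x : nat -> T) :
  exists2 phi : nat -> nat, injective phi &
    (exists v, forall k, x (phi k) = v) \/ injective (x \o phi).
Proof.
have [xfin|xinf] := pselect (finite_set (range x)).
  have [phi pinj pc] := const_subsequence xfin.
  by exists phi => //; left; exists (x (phi 0%N)).
have [u uinj ux] := infinite_injection xinf.
have /choice [phi pu] : forall k, exists i, x i = u k.
  by move=> k; have [i _ <-] := ux k; exists i.
have xphi : injective (x \o phi) by move=> i j /=; rewrite !pu => /uinj.
exists phi; last by right.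
by move=> i j pij; apply: xphi; rewrite /= pij.
Qed.

Lemma subsequence_or (P Q : nat -> Prop) :
  (forall k, P k \/ Q k) ->
  exists2 phi : nat -> nat, injective phi &
    (forall k, P (phi k)) \/ (forall k, Q (phi k)).
Proof.
move=> PQ.
have fin : finite_set (range (fun k => `[< P k >])) by exact: finite_finset.
have [phi pinj pc] := const_subsequence fin.
exists phi => //; have [P0|nP0] := pselect (P (phi 0%N)); [left|right] => k.
  by apply/asboolP; rewrite pc; apply/asboolP.
have [Pk|//] := PQ (phi k); case: nP0.
by apply/asboolP; rewrite -(pc k); apply/asboolP.
Qed.

(** * Hyperbolic length functions *)

Definition gproduct (G : groupType) (len : G -> rat) (x y : G) : rat :=
  ((len x + len y - len (x^-1 * y)%g) / 2%:R)%R.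

(** The word length enters only through these properties. [length_midpoint] stands in for geodesics,
    up to rounding; [length_hyp] is the four-point condition at base point 1, with the minimum split
    into a disjunction. *)
Record hyperbolic_length (G : groupType) (len : G -> rat) (delta : rat) : Prop :=
  HyperbolicLength {
    length1 : len 1 = 0%R;
    lengthV : forall x, len x^-1 = len x;
    lengthM : forall x y, (len (x * y)%g <= len x + len y)%R;
    length_ball : forall r, finite_set [set x | (len x <= r)%R];
    length_midpoint : forall x, exists m,
      [/\ (len m + len (m^-1 * x)%g = len x)%R,
          (len x / 2%:R - 1 <= len m)%R & (len m <= len x / 2%:R)%R];
    length_hyp : forall x y z,
      (gproduct len x y - delta <= gproduct len x z)%R \/
      (gproduct len y z - delta <= gproduct len x z)%R }.

Section HyperbolicLengthTheory.
Variables (G : groupType) (len : G -> rat) (delta : rat).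
Hypothesis hlen : hyperbolic_length len delta.
Local Notation gp := (gproduct len).

Let len1 := length1 hlen.
Let lenV := lengthV hlen.
Let lenM := lengthM hlen.
Let ball_finite := length_ball hlen.
Let hyp := length_hyp hlen.

Lemma length_ge0 x : (0 <= len x)%R.
Proof. by have := lenM x x^-1; rewrite mulgV len1 lenV; lra. Qed.

Lemma delta_ge0 : (0 <= delta)%R.
Proof.
have := hyp 1 1 1; rewrite /gproduct mulVg len1; lra.
Qed.

Lemma gproductC x y : gp x y = gp y x.
Proof.
rewrite /gproduct -(lenV (x^-1 * y)) !gnorm; lra.
Qed.

Lemma lengthB x y : (len x <= len y + len (x^-1 * y)%g)%R.
Proof.
have := lenM y (y^-1 * x); rewrite mulgA mulgV mul1g.
by rewrite -(lenV (y^-1 * x)) !gnorm.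
Qed.

Lemma lengthB' x y : (len y <= len x + len (x^-1 * y)%g)%R.
Proof. by have := lenM x (x^-1 * y); rewrite mulgA mulgV mul1g. Qed.

Lemma gproduct_ge0 x y : (0 <= gp x y)%R.
Proof. by have := lenM x^-1 y; rewrite lenV /gproduct; lra. Qed.

Lemma gproduct_lel x y : (gp x y <= len x)%R.
Proof. by have := lengthB' x y; rewrite /gproduct; lra. Qed.

Lemma gproduct_ler x y : (gp x y <= len y)%R.
Proof. by rewrite gproductC gproduct_lel. Qed.

Lemma gproduct_complement x y : (gp x y + gp x^-1 (x^-1 * y)%g = len x)%R.
Proof. by rewrite /gproduct lenV !gnorm; lra. Qed.

Lemma gproductMr x y u : (`|gp x (y * u)%g - gp x y| <= len u)%R.
Proof.
have := lenM y u; have := lenM (y * u) u^-1.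
have := lenM (x^-1 * y) u; have := lenM (x^-1 * y * u) u^-1.
rewrite !gnorm lenV /gproduct !gnorm => *.
by rewrite ler_distl; apply/andP; split; lra.
Qed.

Lemma gproductMl x y u : (`|gp (x * u)%g y - gp x y| <= len u)%R.
Proof. by rewrite !(gproductC _ y) gproductMr. Qed.

Lemma length_unbounded (u : nat -> G) : injective u ->
  forall r, exists K, forall k, (K <= k)%N -> (r < len (u k))%R.
Proof.
move=> uinj r; apply: contrapT => /forallNP nK.
have /choice [phi pu] : forall K, exists k, (K <= k)%N /\ (len (u k) <= r)%R.
  move=> K; have /existsNP [k /not_implyP [Kk /negP]] := nK K.
  by rewrite -leNgt => uk; exists k.
have fin : finite_set [set k | (len (u k) <= r)%R].
  by apply: (@finite_preimage _ _ _ u) (ball_finite r) => i j _ _; exact: uinj.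
(* The sum [S] of all [k] with [u k] in the ball bounds each of them, against [S < phi S.+1]. *)
case/finite_seqP: fin => s es; set S := (\sum_(i <- s) i)%N.
have [Kphi lphi] := pu S.+1.
have phis : phi S.+1 \in s.
  by have : [set k | (len (u k) <= r)%R] (phi S.+1) by []; rewrite es.
move: (phi S.+1) phis Kphi => p ps.
by rewrite ltnNge /S (big_rem p ps) leq_addr.
Qed.

Lemma length_unbounded1 (u : nat -> G) : injective u ->
  forall r, exists k, (r < len (u k))%R.
Proof.
by move=> /length_unbounded uu r; have [K uK] := uu r; exists K; exact: uK.
Qed.

Lemma finite_length_bound (A : set G) : finite_set A ->
  exists r, forall x, A x -> (len x <= r)%R.
Proof.
case/finite_seqP => s ->; exists (\sum_(x <- s) len x)%R => x xs.
rewrite (big_rem x xs) /= lerDl sumr_ge0 // => y _; exact: length_ge0.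
Qed.

Definition dist x y : rat := len (x^-1 * y).

Lemma distC x y : dist x y = dist y x.
Proof. by rewrite /dist -lenV !gnorm. Qed.

Lemma dist_triangle y x z : (dist x z <= dist x y + dist y z)%R.
Proof. by have := lenM (x^-1 * y) (y^-1 * z); rewrite /dist !gnorm. Qed.

Lemma dist1 x : dist 1 x = len x.
Proof. by rewrite /dist !gnorm. Qed.

Lemma distM g x y : dist (g * x) (g * y) = dist x y.
Proof. by rewrite /dist !gnorm. Qed.

Lemma four_point x y z w :
  (dist x z + dist y w <= dist x y + dist z w + 2%:R * delta)%R \/
  (dist x z + dist y w <= dist y z + dist x w + 2%:R * delta)%R.
Proof.
have := hyp (w^-1 * x) (w^-1 * y) (w^-1 * z).
rewrite /gproduct -!/(dist _ _) !distM !(distC w) => -[]; first by left; lra.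
by right; lra.
Qed.

(** Segments with close endpoints fellow-travel away from their ends. The four-point inequality is
    used twice, replacing [q'] by [q] and then [p'] by [p]; the last two hypotheses exclude its
    other alternative. *)
Lemma near_segment p q p' q' a R E :
  (0 <= E)%R -> (dist p p' <= R)%R -> (dist q q' <= R)%R ->
  (dist p' a + dist a q' <= dist p' q' + E)%R ->
  (R + E + 2%:R * delta < dist p' a)%R -> (R + E + 2%:R * delta < dist a q')%R ->
  (dist p a + dist a q <= dist p q + E + 4%:R * delta)%R.
Proof.
move=> E0 pR qR aE ap aq; have d0 := delta_ge0.
have t1 := dist_triangle q a q'.
have t2 := dist_triangle p p' a; rewrite (distC p' p) in t2.
have aqE : (dist p' a + dist a q <= dist p' q + E + 2%:R * delta)%R.
  by have := four_point a p' q q'; rewrite (distC a p'); case; lra.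
by have := four_point p p' a q; case; lra.
Qed.

Lemma dist_position p q z w E :
  (dist p z + dist z q <= dist p q + E)%R ->
  (dist p w + dist w q <= dist p q + E)%R ->
  (dist z w <= dist p w - dist p z + E + 2%:R * delta)%R \/
  (dist z w <= dist p z - dist p w + E + 2%:R * delta)%R.
Proof.
move=> zE wE.
by have := four_point z p w q; rewrite (distC z p); case=> ?; [right|left]; lra.
Qed.

(* A midpoint [m] of [1, Q] is shifted along the segment by any short [g]
   commuting with [Q]; [g * g] then shifts it twice as far. *)
Lemma midpoint_displacement Q g m R :
  g * Q = Q * g -> (len g <= R)%R ->
  (len m + len (m^-1 * Q)%g = len Q)%R ->
  (2%:R * R + 4%:R * delta < len m)%R ->
  (2%:R * R + 4%:R * delta < len (m^-1 * Q)%g)%R ->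
  (dist m (g * g * m) <= dist m (g * m) + 3%:R * delta)%R ->
  (dist m (g * m) <= 17%:R * delta)%R.
Proof.
move=> gQ gR mQ m1 m2 mgg; have d0 := delta_ge0; have g0 := length_ge0 g.
rewrite -(dist1 m) -(dist1 Q) -/(dist m Q) in mQ m1 m2.
have dg : dist 1 g = len g by exact: dist1.
have dgm : dist g (g * m) = dist 1 m by rewrite -{1}(mulg1 g) distM.
have dgQ : dist g (g * Q) = dist 1 Q by rewrite -{1}(mulg1 g) distM.
have dQ : dist Q (g * Q) = len g by rewrite gQ /dist mulKg.
(* [g * m] lies on [g, g * Q], whose ends are close to 1 and, because [g] commutes with [Q], to [Q];
   so it nearly lies on [1, Q]. *)
have : (dist 1 (g * m) + dist (g * m) Q <= dist 1 Q + 0 + 4%:R * delta)%R.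
  by apply: (@near_segment 1 Q g (g * Q) (g * m) R 0%R);
    rewrite ?distM ?dgm ?dgQ ?dQ ?dg; lra.
rewrite addr0 => near.
have pos := @dist_position 1 Q m (g * m) (4%:R * delta)%R _ near.
have t1 := dist_triangle g 1 (g * m).
have t2 := dist_triangle 1 g (g * m); rewrite (distC g 1) in t2.
have t4 := dist_triangle m 1 (g * g * m).
have t5 := dist_triangle (g * g * m) 1 m.
have t6 := dist_triangle (g * m) g (g * g * m).
have dggm : dist g (g * g * m) = dist 1 (g * m).
  by rewrite -{1}(mulg1 g) -mulgA distM.
have dgm2 : dist (g * m) (g * g * m) = dist m (g * m) by rewrite -mulgA distM.
rewrite (distC (g * g * m)) in t5.
(* Far from the ends, [f1] and [f2] give |g g m| = 2 |g m| - |m| up to 2 delta. For d = dist m (g *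
   m), [pos'] then yields dist m (g * g * m) >= 2 (d - 6 delta) - 2 delta; as this distance is at
   most d + 3 delta, d <= 17 delta. *)
have f1 := four_point 1 g (g * m) (g * g * m).
have f2 := four_point 1 g (g * g * m) (g * m).
rewrite (distC (g * g * m) (g * m)) in f2.
have pos' : (dist m (g * m) <= dist 1 (g * m) - dist 1 m + 6%:R * delta)%R \/
  (dist m (g * m) <= dist 1 m - dist 1 (g * m) + 6%:R * delta)%R.
  by case: pos => [|?|?]; [lra|left; lra|right; lra].
rewrite dg dgm dggm dgm2 in t1 t2 t4 t5 t6 f1 f2.
case: pos' => p'; case: f1 => f1; case: f2 => f2; lra.
Qed.

(** * Powers of an element of infinite order *)

(** Up to a bounded error, 1 lies on every segment from [c ^- i] to [c ^+ j]; by translation, the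
    powers of [c] lie in order along a line. *)
Definition bounded_axis c (C : rat) : Prop :=
  forall i j, (gp (c ^- i) (c ^+ j) <= C)%R.

Lemma length_exp c n : (len (c ^+ n) <= n%:R * len c)%R.
Proof.
elim: n => [|n IHn]; first by rewrite expg0 len1 mul0r.
by have := lenM c (c ^+ n); rewrite expgS -natr1; lra.
Qed.

(** By induction (h | h^(j+2)) = |h| - (h^-1 | h^(j+1)) is large. If (h^-1 | h^(j+2)) were large
    too, then so would be (h^-1 | h), against the long square. *)
Lemma gproduct_chain h j : (len h + 2%:R * delta < len (h * h)%g)%R ->
  (gp h^-1 (h ^+ j.+1) <= gp h^-1 h + delta)%R.
Proof.
move=> hh; have d0 := delta_ge0.
have hVh : (gp h^-1 h = len h - len (h * h)%g / 2%:R)%R.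
  by rewrite /gproduct lenV invgK; lra.
elim: j => [|j IHj]; first by rewrite expg1; lra.
have := gproduct_complement h (h ^+ j.+2); rewrite [in X in _ -> X]expgS mulKg.
rewrite gproductC => hj.
by have := hyp h^-1 (h ^+ j.+2) h => -[]; lra.
Qed.

(** The chain estimate for [h^-1] makes (h^-1 | h^-(i+2)) large, while that for [h] bounds (h^-1 |
    h^(j+1)). One more use of hyperbolicity costs the third delta. *)
Lemma long_square_bounded_axis h : (len h + 3%:R * delta < len (h * h)%g)%R ->
  exists C, bounded_axis h C.
Proof.
move=> hh; have d0 := delta_ge0; have g0 := gproduct_ge0 h^-1 h.
have hVh : (gp h^-1 h = len h - len (h * h)%g / 2%:R)%R.
  by rewrite /gproduct lenV invgK; lra.
exists (gp h^-1 h + 2%:R * delta)%R => -[|i] j.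
  by rewrite expg0 invg1; have := gproduct_lel 1 (h ^+ j); rewrite len1; lra.
case: j => [|j].
  by rewrite expg0; have := gproduct_ler (h ^- i.+1) 1; rewrite len1; lra.
have hj : (gp h^-1 (h ^+ j.+1) <= gp h^-1 h + delta)%R.
  by apply: gproduct_chain; lra.
have hi : (gp h (h ^- i.+1) <= gp h^-1 h + delta)%R.
  have := @gproduct_chain h^-1 i; rewrite invgK (gproductC h h^-1) expVgn; apply.
  by rewrite -invgM !lenV; lra.
case: i hi => [|i] hi; first by rewrite expg1; lra.
have hi' : (gp h (h ^- i.+1) <= gp h^-1 h + delta)%R.
  have := @gproduct_chain h^-1 i; rewrite invgK (gproductC h h^-1) expVgn; apply.
  by rewrite -invgM !lenV; lra.
have hE : h^-1^-1 * h ^- i.+2 = h ^- i.+1.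
  by rewrite expgSr invgM invgK mulVKg.
have := gproduct_complement h^-1 (h ^- i.+2); rewrite hE invgK lenV => hc.
by case: (hyp h^-1 (h ^- i.+2) (h ^+ j.+1)) => ?; lra.
Qed.

Lemma gproductMMl y u v : (gp (y * u)%g (y * v)%g <= gp u v + len y)%R.
Proof.
have := lenM y u; have := lenM y v; rewrite /gproduct !gnorm.
lra.
Qed.

Lemma gproduct_perturb x y u v :
  (gp (x * u)%g (y * v)%g <= gp x y + len u + len v)%R.
Proof.
have := gproductMl x (y * v) u; have := gproductMr x y v.
by rewrite !ler_distl => /andP[_ ?] /andP[_ ?]; lra.
Qed.

(** Division of the exponent by [N] writes [c ^+ i] as [y] times a power of the conjugate times a
    factor of bounded length. *)
Lemma bounded_axis_root c y N C : (0 < N)%N ->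
  bounded_axis (y^-1 * c ^+ N * y) C -> exists C', bounded_axis c C'.
Proof.
move=> N0 hC.
have cE i : c ^+ i = y * (y^-1 * c ^+ N * y) ^+ (i %/ N) * (y^-1 * c ^+ (i %% N)).
  have -> : y^-1 * c ^+ N * y = (c ^+ N) ^ y by rewrite conjgE mulgA.
  by rewrite -conjXg conjgE !gnorm -expgnA -expgnDr mulnC -divn_eq.
have yc i : (len (y^-1 * c ^+ (i %% N)) <= len y + N%:R * len c)%R.
  have := lenM y^-1 (c ^+ (i %% N)); rewrite lenV.
  have := length_exp c (i %% N).
  have : ((i %% N)%N%:R * len c <= N%:R * len c)%R.
    by apply: ler_wpM2r; [exact: length_ge0 | rewrite ler_nat ltnW ?ltn_pmod].
  lra.
exists (C + len y + (len y + N%:R * len c) + (len y + N%:R * len c))%R => i j.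
have cVE : c ^- i =
    y * (y^-1 * c ^+ N * y) ^- (i %/ N) * (y^-1 * c ^- (i %% N)).
  have -> : y^-1 * c ^+ N * y = (c ^+ N) ^ y by rewrite conjgE mulgA.
  rewrite -conjXg conjgE !gnorm -expgnA -invgM -expgnDr.
  by rewrite addnC mulnC -divn_eq.
have ycV : (len (y^-1 * c ^- (i %% N)) <= len y + N%:R * len c)%R.
  have := lenM y^-1 (c ^- (i %% N)); rewrite !lenV.
  have := length_exp c (i %% N).
  have : ((i %% N)%N%:R * len c <= N%:R * len c)%R.
    by apply: ler_wpM2r; [exact: length_ge0 | rewrite ler_nat ltnW ?ltn_pmod].
  lra.
rewrite cVE (cE j); set h := _ * y.
have := gproduct_perturb (y * h ^- (i %/ N)) (y * h ^+ (j %/ N))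
  (y^-1 * c ^- (i %% N)) (y^-1 * c ^+ (j %% N)).
have := gproductMMl y (h ^- (i %/ N)) (h ^+ (j %/ N)).
have := hC (i %/ N) (j %/ N); have := yc j; rewrite -/h; lra.
Qed.

Lemma infinite_order_bounded_axis c : injective (fun n => c ^+ n) ->
  exists C, bounded_axis c C.
Proof.
move=> cinj; have d0 := delta_ge0.
have [[N [y [N0 Ny]]]|noN] := pselect (exists N y, (0 < N)%N /\
    let h := y^-1 * c ^+ N * y in (len h + 3%:R * delta < len (h * h)%g)%R).
  have [C hC] := long_square_bounded_axis Ny.
  exact: bounded_axis_root hC.
(* The conjugates [m^-1 * c ^+ i * m] with [i < N] will all lie in this ball, which has fewer than
   [N] elements. *)
have /finite_seqP [s es] := ball_finite (17%:R * delta)%R.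
set N := (size s).+1; set R : rat := (N%:R * len c)%R.
(* Half of this bound, less 1 for the rounding of the midpoint, is the 2 R + 4 delta required on
   both sides of [m]. *)
have [M LM] := length_unbounded1 cinj (4%:R * R + 8%:R * delta + 2%:R)%R.
have [m [mM m1 m2]] := length_midpoint hlen (c ^+ M).
have ms i : (i < N)%N -> m^-1 * c ^+ i * m \in s.
  move=> iN; have : [set x | (len x <= 17%:R * delta)%R] (m^-1 * c ^+ i * m).
    rewrite -mulgA; case: i iN => [|i] iN.
      by rewrite expg0 mul1g mulVg /= len1; lra.
    apply: (@midpoint_displacement (c ^+ M) (c ^+ i.+1) m R).
    - exact/commute_sym/commuteX2.
    - apply: le_trans (length_exp _ _) _; apply: ler_wpM2r; first exact: length_ge0.
      by rewrite ler_nat ltnW.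
    - exact: mM.
    - by move: LM => /=; lra.
    - by move: LM => /=; lra.
    rewrite leNgt; apply/negP => h1; apply: noN; exists i.+1, m.
    by split=> //=; move: h1; rewrite /dist !gnorm; lra.
  by rewrite es.
have : (size [seq (m^-1 * c ^+ i * m)%g | i <- iota 0 N] <= size s)%N.
  apply: uniq_leq_size; last first.
    by move=> x /mapP [i]; rewrite mem_iota => /andP[_ iN] ->; exact: ms.
  by rewrite map_inj_uniq ?iota_uniq // => i j /mulIg /mulgI /cinj.
by rewrite size_map size_iota ltnn.
Qed.

End HyperbolicLengthTheory.

(** * Commensurators and maximal elementary subgroups *)

(** This carries the sign of an exponent, so that exponents remain natural numbers. *)
Definition eq_upto_inv (G : groupType) (x y : G) : Prop := x = y \/ x = y^-1.

Definition commensurator (G : groupType) (c : G) : set G :=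
  [set x | exists p q, [/\ (0 < p)%N, (0 < q)%N &
    eq_upto_inv ((c ^+ p) ^ x) (c ^+ q)]].

Section CyclicSubgroups.
Variable G : groupType.
Implicit Types (c d x y z : G) (A : set G).
Local Notation "x =~ y" := (eq_upto_inv x y) (at level 70).

Lemma eq_upto_inv_sym x y : x =~ y -> y =~ x.
Proof. by case=> ->; [left|right; rewrite invgK]. Qed.

Lemma eq_upto_inv_trans y x z : x =~ y -> y =~ z -> x =~ z.
Proof.
by move=> [->|->] [->|->]; rewrite ?invgK; [left|right|right|left].
Qed.

Lemma eq_upto_invX x y n : x =~ y -> x ^+ n =~ y ^+ n.
Proof. by case=> ->; [left|right; rewrite expVgn]. Qed.

Lemma eq_upto_invJ x y z : x =~ y -> x ^ z =~ y ^ z.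
Proof. by case=> ->; [left|right; rewrite conjVg]. Qed.

Lemma cyclic_spanE c z : cyclic_span c z <-> exists i j, z = c ^- i * c ^+ j.
Proof.
split=> [[k [->|->]]|[i [j ->]]].
- by exists 0%N, k; rewrite expg0 invg1 mul1g.
- by exists k, 0%N; rewrite mulg1.
have [ij|/ltnW ji] := leqP i j.
  by exists (j - i)%N; left; rewrite -{1}(subnKC ij) expgnDr mulKg.
by exists (i - j)%N; right; rewrite -{1}(subnKC ji) expgnDr invgM mulgVK.
Qed.

Lemma cyclic_spanV c z : cyclic_span c z -> cyclic_span c z^-1.
Proof. by case=> k [->|->]; exists k; [right|left; rewrite invgK]. Qed.

Lemma cyclic_spanM c z w :
  cyclic_span c z -> cyclic_span c w -> cyclic_span c (z * w).
Proof.
move=> /cyclic_spanE [i [j ->]] /cyclic_spanE [k [l ->]].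
apply/cyclic_spanE; exists (i + k)%N, (j + l)%N.
rewrite addnC !expgnDr invgM !mulgA; congr (_ * _); rewrite -!mulgA; congr (_ * _).
exact: commuteV (commuteX2 _ _ (commute_refl c)).
Qed.

Lemma subgroupV A x : subgroup A -> A x -> A x^-1.
Proof. by case=> A1 AB Ax; rewrite -(mul1g x^-1); exact: AB. Qed.

Lemma subgroupM A x y : subgroup A -> A x -> A y -> A (x * y).
Proof.
move=> sA Ax Ay; rewrite -(invgK y); apply: (proj2 sA) => //.
exact: subgroupV.
Qed.

Lemma subgroupX A x n : subgroup A -> A x -> A (x ^+ n).
Proof.
move=> sA Ax; elim: n => [|n IHn]; first exact: (proj1 sA).
by rewrite expgS; exact: subgroupM.
Qed.

Lemma mem_lcoset c x : setmul [set x] (cyclic_span c) x.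
Proof.
exists x => //; exists 1; last by rewrite mulg1.
by exists 0%N; left.
Qed.

Lemma lcosetP A x y : setmul [set x] A y -> exists2 z, A z & y = x * z.
Proof. by case=> _ -> [z Az <-]; exists z. Qed.

Lemma lcoset_span c x z : cyclic_span c z ->
  setmul [set x * z] (cyclic_span c) = setmul [set x] (cyclic_span c).
Proof.
move=> cz; rewrite predeqE => y; split=> /lcosetP [w cw ->].
  by exists x => //; exists (z * w); [exact: cyclic_spanM | rewrite mulgA].
exists (x * z) => //; exists (z^-1 * w); last by rewrite !gnorm.
by apply: cyclic_spanM => //; exact: cyclic_spanV.
Qed.

Lemma commensurator_subgroup c : subgroup (commensurator c).
Proof.
have commV x : commensurator c x -> commensurator c x^-1.
  move=> [p [q [p0 q0 pq]]]; exists q, p; split=> //.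
  apply: eq_upto_inv_sym; have := eq_upto_invJ x^-1 pq.
  by rewrite conjgK.
split=> [|x y cx /commV [r [s [r0 s0 rs]]]].
  by exists 1%N, 1%N; split=> //; left; rewrite conjg1.
case: cx => p [q [p0 q0 pq]]; exists (p * r)%N, (q * s)%N.
rewrite !muln_gt0 p0 q0 r0 s0; split=> //.
have := eq_upto_invX r pq; rewrite -conjXg -expgnA => /(eq_upto_invJ y^-1).
rewrite -conjgM => /eq_upto_inv_trans; apply.
have := eq_upto_invX q rs; rewrite -conjXg -!expgnA mulnC.
by rewrite [(s * q)%N]mulnC.
Qed.

Lemma commensurator_sub c d p q : (0 < p)%N -> (0 < q)%N ->
  c ^+ p =~ d ^+ q -> commensurator c `<=` commensurator d.
Proof.
move=> p0 q0 cd x [r [s [r0 s0 rs]]]; exists (q * r)%N, (q * s)%N.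
rewrite !muln_gt0 q0 r0 s0; split=> //.
have := eq_upto_invJ x (eq_upto_invX r (eq_upto_inv_sym cd)).
rewrite -!expgnA => /eq_upto_inv_trans; apply.
have := eq_upto_invX p rs; rewrite -conjXg -!expgnA mulnC.
move=> /eq_upto_inv_trans; apply; rewrite mulnC.
by have := eq_upto_invX s cd; rewrite -!expgnA.
Qed.

Lemma commensurator_eq c d p q : (0 < p)%N -> (0 < q)%N ->
  c ^+ p =~ d ^+ q -> commensurator c = commensurator d.
Proof.
move=> p0 q0 cd; apply/seteqP; split; first exact: commensurator_sub cd.
by apply: commensurator_sub (eq_upto_inv_sym cd).
Qed.

Lemma infinite_orderP c : (forall n, (0 < n)%N -> c ^+ n <> 1) ->
  injective (fun n => c ^+ n).
Proof.
move=> cn; have lt i j : (i < j)%N -> c ^+ i <> c ^+ j.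
  move=> ij; rewrite -(subnKC (ltnW ij)) expgnDr -{1}(mulg1 (c ^+ i)).
  by move/mulgI/esym; apply: cn; rewrite subn_gt0.
move=> i j /= cij; case: (ltngtP i j) => [/lt//|/lt|//].
by rewrite cij.
Qed.

(** Among the finitely many cosets, two of the form c^k x <c> coincide; hence a positive power of
    [c] is conjugated by [x] into <c>, and not to 1 since [c] has infinite order. *)
Lemma elementary_sub_commensurator A c : subgroup A -> A c ->
  finite_set (left_cosets A (cyclic_span c)) ->
  injective (fun n => c ^+ n) -> A `<=` commensurator c.
Proof.
move=> sA Ac fin cinj x Ax.
have rfin : finite_set (range (fun k => setmul [set c ^+ k * x] (cyclic_span c))).
  apply: sub_finite_set fin => _ [k _ <-]; exists (c ^+ k * x) => //.
  by apply: subgroupM => //; exact: subgroupX.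
have [i [j [ij eij]]] := finite_range_collision rfin.
have := mem_lcoset c (c ^+ j * x); rewrite -eij => /lcosetP [w].
case=> q cw /(congr1 (fun y => x^-1 * (c ^- i * y))).
rewrite -(subnKC (ltnW ij)) expgnDr !gnorm => cij.
have p0 : (0 < j - i)%N by rewrite subn_gt0.
exists (j - i)%N, q; split=> //; last by rewrite conjgE mulgA cij.
case: q cw => // cw.
have w1 : w = 1 by case: cw; rewrite ?expg0 ?invg1.
move: cij; rewrite w1 => /(congr1 (fun y => x * y * x^-1)).
rewrite !gnorm => cij; have := @cinj (j - i)%N 0%N cij.
by move=> ij0; rewrite ij0 in p0.
Qed.
End CyclicSubgroups.

(** * Commensurators in the presence of a hyperbolic length *)

Section ElementarySubgroups.
Variables (G : groupType) (len : G -> rat) (delta : rat).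
Hypothesis hlen : hyperbolic_length len delta.
Implicit Types (c d x y z : G) (A B : set G).
Local Notation gp := (gproduct len).
Local Notation dist := (dist len).

Lemma gproduct_dist x q : (gp x^-1 (x^-1 * q)%g = (len x + dist x q - len q) / 2%:R)%R.
Proof. by rewrite /gproduct /dist (lengthV hlen) !gnorm. Qed.

(** The first hypothesis on [x] puts it near the segment [1, c^n]. The least [j] with |x| <= |c^j|
    gives a point near the same segment and about as far from 1, so [dist_position] applies. *)
Lemma bounded_axis_near c C C1 : bounded_axis len c C ->
  exists K, forall n x, (gp x^-1 (x^-1 * c ^+ n)%g <= C1)%R ->
    (len x <= len (c ^+ n))%R ->
    exists2 j, (j <= n)%N & (len (x^-1 * c ^+ j)%g <= K)%R.
Proof.
move=> cC; exists (len c + 2%:R * C1 + 2%:R * C + 2%:R * delta)%R => n x xn lxn.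
have C0 : (0 <= C)%R by apply: le_trans (cC 0%N 0%N); exact: gproduct_ge0 hlen _ _.
have C10 : (0 <= C1)%R by apply: le_trans xn; exact: gproduct_ge0 hlen _ _.
have exj : exists j, (len x <= len (c ^+ j))%R by exists n.
have [j ljx jmin] := ex_minnP exj.
have jn : (j <= n)%N by exact: jmin.
exists j => //.
have c0 := length_ge0 hlen c.
have ljc : (len (c ^+ j) <= len x + len c)%R.
  case: j ljx jmin jn => [|j] ljx jmin jn.
    by rewrite expg0 (length1 hlen); have := length_ge0 hlen x; lra.
  have : ~~ (len x <= len (c ^+ j))%R by apply/negP => /jmin; rewrite ltnn.
  by rewrite -ltNge expgS => ?; have := lengthM hlen c (c ^+ j); lra.
have := cC j (n - j)%N.
have -> : c ^+ (n - j) = (c ^+ j)^-1 * c ^+ n by rewrite -{2}(subnKC jn) expgnDr mulKg.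
rewrite gproduct_dist => cj; rewrite gproduct_dist in xn.
rewrite -/(dist x (c ^+ j)).
have := @dist_position _ _ _ hlen 1 (c ^+ n) x (c ^+ j) (2%:R * C + 2%:R * C1)%R.
rewrite !(dist1 len) => pos.
by case: pos => [| |?|?]; lra.
Qed.

(** With r = c^(qk) or its inverse, c^(pk) x = x r, so [x] nearly lies between [P * x] and [Q * x].
    These are within |x| of [P] and [Q], so for large [k] also [x] is near [P, Q]. Only [k] depends
    on [x], not [K]. *)
Lemma commensurator_near_axis c C : injective (fun n => c ^+ n) ->
  bounded_axis len c C -> exists K, forall x, commensurator c x ->
    exists2 z, cyclic_span c z & (len (x^-1 * z)%g <= K)%R.
Proof.
move=> cinj cC.
have [K hK] := bounded_axis_near (C + 2%:R * delta)%R cC.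
exists K => x [p [q [p0 q0 pq]]].
have d0 := delta_ge0 hlen.
have C0 : (0 <= C)%R by apply: le_trans (cC 0%N 0%N); exact: gproduct_ge0 hlen _ _.
have [k hk] := length_unbounded hlen cinj (len x + 2%:R * C + 4%:R * delta)%R.
have lp : (len x + 2%:R * C + 4%:R * delta < len (c ^+ (p * k)))%R.
  by apply: hk; rewrite leq_pmull.
have lq : (len x + 2%:R * C + 4%:R * delta < len (c ^+ (q * k)))%R.
  by apply: hk; rewrite leq_pmull.
set P := c ^- (p * k); set Q := c ^+ (p * k) in lp.
have [r [Qx lr]] : exists r, Q * x = x * r /\
    [/\ (len x + 2%:R * C + 4%:R * delta < len r)%R &
      (2%:R * len r <= len (r * r)%g + 2%:R * C)%R].
  have rr : (2%:R * len (c ^+ (q * k)) <=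
      len (c ^+ (q * k) * c ^+ (q * k))%g + 2%:R * C)%R.
    by have := cC (q * k)%N (q * k)%N; rewrite /gproduct (lengthV hlen) invgK; lra.
  have := eq_upto_invX k pq; rewrite -conjXg -!expgnA -/Q => -[] xQ.
    by exists (c ^+ (q * k)); split; [rewrite -xQ conjgE mulVKg | split].
  exists (c ^- (q * k)); split; first by rewrite -xQ conjgE mulVKg.
  by rewrite -invgM !(lengthV hlen).
case: lr => lr rr.
have Px : P * x = x * r^-1.
  have -> : P = Q^-1 by [].
  by apply: (mulIg r); rewrite mulgVK -mulgA -Qx mulKg.
have seg : (dist P x + dist x Q <= dist P Q + 2%:R * C + 4%:R * delta)%R.
  apply: (@near_segment _ _ _ hlen P Q (P * x) (Q * x) x (len x)).
  - lra.
  - by rewrite /dist mulKg.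
  - by rewrite /dist mulKg.
  - rewrite Px Qx /dist !gnorm; lra.
  - by rewrite Px /dist !gnorm; lra.
  - by rewrite Qx /dist !gnorm; lra.
have lPx : dist P x = len (Q * x) by rewrite /dist /P invgK.
have dQx : dist x Q = dist (Q * x) (c ^+ (p * k + p * k)).
  by rewrite expgnDr (distM len).
have dPQ : dist P Q = len (c ^+ (p * k + p * k)).
  by rewrite /dist /P invgK expgnDr.
have far := lengthB hlen Q x; rewrite -(lengthV hlen (Q^-1 * x)) !gnorm in far.
(* Translation by [Q] makes the segment [P, Q] start at 1. *)
have [||j _ jK] := hK (p * k + p * k)%N (Q * x).
- by rewrite gproduct_dist; lra.
- by move: seg; rewrite lPx dPQ /dist; lra.
exists (P * c ^+ j); first by apply/cyclic_spanE; exists (p * k)%N, j.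
by move: jK; rewrite invgM mulgA.
Qed.

Lemma commensurator_elementary c : injective (fun n => c ^+ n) ->
  elementary (commensurator c).
Proof.
move=> cinj; have [C cC] := infinite_order_bounded_axis hlen cinj.
have [K hK] := commensurator_near_axis cinj cC.
split; first exact: commensurator_subgroup.
exists c; first by exists 1%N, 1%N; split=> //; left; rewrite conjgE mulKg.
apply: sub_finite_set (finite_image (fun x => setmul [set x] (cyclic_span c))
  (length_ball hlen K)).
move=> _ [x cx <-].
(* For [x^-1] the bound reads [len (x * z) <= K]: every coset meets one fixed ball. *)
have [z cz zK] := hK _ (subgroupV (commensurator_subgroup c) cx).
exists (x * z); first by rewrite -(invgK x).
by rewrite lcoset_span.
Qed.

Lemma left_cosets_cover A c :
  subgroup A -> finite_set (left_cosets A (cyclic_span c)) ->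
  exists R, forall a, A a -> exists2 z, cyclic_span c z & (len (z^-1 * a)%g <= R)%R.
Proof.
move=> sA fin.
(* [R] bounds one chosen representative per coset; that of the coset of [a^-1] is some [a^-1 * z],
   the inverse of [z^-1 * a]. *)
have [R hR] := finite_length_bound hlen (finite_image (xget 1) fin).
exists R => a Aa; set X := setmul [set a^-1] (cyclic_span c).
have Xcoset : left_cosets A (cyclic_span c) X.
  by exists a^-1 => //; exact: subgroupV.
have : X (xget 1 X) by apply: xgetI (mem_lcoset _ _).
move=> /lcosetP [z cz xX]; exists z => //.
rewrite -(lengthV hlen) !gnorm -xX; apply: hR; exists X => //.
Qed.

Lemma infinite_subgroup_order A c : infinite_set A -> subgroup A ->
  finite_set (left_cosets A (cyclic_span c)) -> injective (fun n => c ^+ n).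
Proof.
move=> Ainf sA fin; apply: infinite_orderP => p p0 cp; apply: Ainf.
have [R hR] := left_cosets_cover sA fin.
apply: sub_finite_set (length_ball hlen (p%:R * len c + R)%R) => a /hR [z cz za].
have zp : (len z <= p%:R * len c)%R.
  have cE k : c ^+ k = c ^+ (k %% p).
    by rewrite {1}(divn_eq k p) expgnDr mulnC expgnA cp expg1n mul1g.
  have ck k : (len (c ^+ k) <= p%:R * len c)%R.
    rewrite cE; apply: le_trans (length_exp hlen _ _) _.
    apply: ler_wpM2r; first exact: length_ge0 hlen _.
    by rewrite ler_nat ltnW ?ltn_pmod.
  by case: cz => k [->|->]; rewrite ?(lengthV hlen).
have := lengthM hlen z (z^-1 * a); rewrite mulVKg /=; lra.
Qed.

Lemma infinite_maximal_elementaryP A : maximal_elementary A -> infinite_set A ->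
  exists c, [/\ injective (fun n => c ^+ n), A = commensurator c &
    exists R, forall a, A a -> exists2 z, cyclic_span c z & (len (z^-1 * a)%g <= R)%R].
Proof.
move=> [[sA [c Ac fin]] Amax] Ainf.
have cinj := infinite_subgroup_order Ainf sA fin.
exists c; split=> //; last exact: left_cosets_cover.
apply/esym/Amax; first exact: commensurator_elementary.
exact: elementary_sub_commensurator.
Qed.

(** When (c^n | d^l) is large, each c^i with [i < N] is near [1, d^l], hence within [K] of a power
    of [d]. By pigeonhole two of the elements c^-i d^(j i) agree, so [c] and [d] have a common
    nontrivial power up to inversion. *)
Lemma powers_gproduct_unbounded c d :
  injective (fun n => c ^+ n) -> injective (fun n => d ^+ n) ->
  (forall N, exists n l, (N < gp (c ^+ n) (d ^+ l))%R) ->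
  commensurator c = commensurator d.
Proof.
move=> cinj dinj unb.
have d0 := delta_ge0 hlen.
have [C cC] := infinite_order_bounded_axis hlen cinj.
have [D dD] := infinite_order_bounded_axis hlen dinj.
have [K hK] := bounded_axis_near (C + delta)%R dD.
have /finite_seqP [s es] := length_ball hlen K.
have [N sN] : exists N, (size s < N)%N by exists (size s).+1.
(* This bounds |c^i| for all [i <= N], and so forces [N <= n]. *)
have [n [l big]] := unb (N%:R * len c)%R.
have c0 := length_ge0 hlen c.
have Nn : (N <= n)%N.
  rewrite leqNgt; apply/negP => nN.
  have : (n%:R * len c <= N%:R * len c)%R.
    by apply: ler_wpM2r => //; rewrite ler_nat ltnW.
  have := length_exp hlen c n; have := gproduct_lel hlen (c ^+ n) (d ^+ l); lra.
have /choice [j hj] : forall i, exists j, (i < N)%N -> c ^- i * d ^+ j \in s.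
  move=> i; case: (ltnP i N) => iN; last by exists 0%N.
  have ic : (len (c ^+ i) <= N%:R * len c)%R.
    apply: le_trans (length_exp hlen _ _) _; apply: ler_wpM2r => //.
    by rewrite ler_nat ltnW.
  have in_ : (i <= n)%N by apply: leq_trans Nn; exact: ltnW.
  have := gproduct_complement hlen (c ^+ i) (c ^+ n).
  rewrite -{2}(subnKC in_) expgnDr mulKg => cin.
  have := cC i (n - i)%N => Ci.
  have := gproduct_complement hlen (c ^+ i) (d ^+ l) => cid.
  have := gproduct_ge0 hlen (c ^- i) (c ^+ (n - i)) => C0.
  have := gproduct_ler hlen (c ^+ n) (d ^+ l) => dl.
  have [||j _ jK] := hK l (c ^+ i).
  - by case: (length_hyp hlen (c ^+ i) (c ^+ n) (d ^+ l)) => ?; lra.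
  - lra.
  exists j => _.
  by have : [set x | (len x <= K)%R] (c ^- i * d ^+ j) by []; rewrite es.
have : ~~ uniq [seq c ^- i * d ^+ j i | i <- iota 0 N].
  apply/negP => /uniq_leq_size us.
  have : (size [seq (c ^- i * d ^+ j i)%g | i <- iota 0 N] <= size s)%N.
    apply: us => x /mapP [i]; rewrite mem_iota => /andP[_ iN] ->; exact: hj.
  by rewrite size_map size_iota leqNgt sN.
move=> /(uniqPn 1) [i [k [ik]]]; rewrite size_map size_iota => kN.
rewrite !(nth_map 0%N) ?size_iota ?(ltn_trans ik) // !nth_iota ?(ltn_trans ik) //.
rewrite !add0n => e.
have p0 : (0 < k - i)%N by rewrite subn_gt0.
have [q cq] : exists q, eq_upto_inv (c ^+ (k - i)) (d ^+ q).
  have : cyclic_span d (c ^+ (k - i)); last by [].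
  have -> : c ^+ (k - i) = d ^+ j k * d ^- j i.
    move: e => /(congr1 (fun y => c ^+ k * y * d ^- j i)).
    by rewrite -{1}(subnKC (ltnW ik)) addnC expgnDr !gnorm.
  by apply: cyclic_spanM; [exists (j k); left | exists (j i); right].
have q0 : (0 < q)%N.
  case: q cq => // cq.
  have : c ^+ (k - i) = c ^+ 0 by case: cq => ->; rewrite !expg0 ?invg1.
  by move/cinj => ki0; rewrite ki0 in p0.
exact: commensurator_eq p0 q0 cq.
Qed.

Lemma injective_expgV c : injective (fun n => c ^+ n) ->
  injective (fun n => c^-1 ^+ n).
Proof. by move=> cinj i j; rewrite !expVgn => /invg_inj /cinj. Qed.

Lemma commensuratorV c : commensurator c^-1 = commensurator c.
Proof. by apply: (@commensurator_eq _ _ _ 1 1) => //; rewrite !expg1; right. Qed.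

(** Elements of [A] and [B] are at bounded distance from powers of [c] and [d]. If the
    commensurators differed, the products of these powers would be bounded for each of the four
    choices of signs. *)
Lemma maximal_elementary_gproduct_unbounded A B :
  maximal_elementary A -> infinite_set A ->
  maximal_elementary B -> infinite_set B ->
  (forall N, exists a b, [/\ A a, B b & (N < gp a b)%R]) -> A = B.
Proof.
move=> Am Ai Bm Bi unb.
have [c [cinj eA [R hR]]] := infinite_maximal_elementaryP Am Ai.
have [d [dinj eB [S hS]]] := infinite_maximal_elementaryP Bm Bi.
rewrite eA eB; apply: contrapT => cd.
have bnd c' d' : injective (fun n => c' ^+ n) -> injective (fun n => d' ^+ n) ->
    commensurator c' <> commensurator d' ->
    exists N, (0 <= N)%R /\ forall n l, (gp (c' ^+ n) (d' ^+ l) <= N)%R.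
  move=> ci di ncd; apply: contrapT => /forallNP nb; apply: ncd.
  apply: powers_gproduct_unbounded => // N.
  apply: contrapT => nN; apply: (nb (Num.max 0%R N)).
  split=> [|n l]; first by rewrite le_max lexx.
  rewrite le_max orbC leNgt; apply/orP; left; apply/negP => ?; apply: nN.
  by exists n, l.
have [N1 [N10 h1]] := bnd c d cinj dinj cd.
have [|N2 [N20 h2]] := bnd _ _ (injective_expgV cinj) dinj.
  by rewrite commensuratorV.
have [|N3 [N30 h3]] := bnd _ _ cinj (injective_expgV dinj).
  by rewrite commensuratorV.
have [|N4 [N40 h4]] := bnd _ _ (injective_expgV cinj) (injective_expgV dinj).
  by rewrite !commensuratorV.
have [a [b [Aa Bb ab]]] := unb (N1 + N2 + N3 + N4 + R + S)%R.
have [z cz za] := hR a Aa; have [w dw wb] := hS b Bb.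
have := gproduct_perturb hlen z w (z^-1 * a) (w^-1 * b).
rewrite !mulVKg => abzw.
have : (gp z w <= N1 + N2 + N3 + N4)%R.
  case: cz => n [->|->]; case: dw => l [->|->]; rewrite -?expVgn.
  - have := h1 n l; clear - N10 N20 N30 N40; lra.
  - have := h3 n l; clear - N10 N20 N30 N40; lra.
  - have := h2 n l; clear - N10 N20 N30 N40; lra.
  - have := h4 n l; clear - N10 N20 N30 N40; lra.
by clear cd eA eB; lra.
Qed.

End ElementarySubgroups.

(** * Conjugates of maximal elementary subgroups *)

Section Conjugates.
Variable G : groupType.
Implicit Types (g h x y : G) (A B : set G).

Lemma conjugate_byE g A x : conjugate_by g A x <-> A (x ^ g).
Proof.
split=> [[a Aa <-]|Ax]; first by rewrite conjgE !gnorm.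
by exists (x ^ g) => //; rewrite conjgE !gnorm.
Qed.

Lemma conjugate_byK g A : conjugate_by g^-1 (conjugate_by g A) = A.
Proof.
apply/seteqP; split=> x; rewrite !conjugate_byE; last by rewrite conjgKV.
by rewrite conjgKV.
Qed.

Lemma conjugate_byKV g A : conjugate_by g (conjugate_by g^-1 A) = A.
Proof. by have := conjugate_byK g^-1 A; rewrite invgK. Qed.

Lemma conjugate_byM g h A :
  conjugate_by g (conjugate_by h A) = conjugate_by (g * h) A.
Proof. by apply/seteqP; split=> x; rewrite !conjugate_byE conjgM. Qed.

Lemma conjugate_byS g A B : A `<=` B -> conjugate_by g A `<=` conjugate_by g B.
Proof. by move=> AB x; rewrite !conjugate_byE; exact: AB. Qed.

Lemma conjugate_by_subgroup g A : subgroup A -> subgroup (conjugate_by g A).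
Proof.
move=> [A1 AB]; split=> [|x y]; rewrite !conjugate_byE ?conj1g // conjMg conjVg.
exact: AB.
Qed.

Lemma conjugate_by_id g A : subgroup A -> A g -> conjugate_by g A = A.
Proof.
move=> sA Ag; apply/seteqP; split=> x; rewrite conjugate_byE => Ax.
  have -> : x = g * x ^ g * g^-1 by rewrite conjgE !gnorm.
  by apply: subgroupM => //; [exact: subgroupM | exact: subgroupV].
by rewrite conjgE; apply: subgroupM => //; [exact: subgroupV | exact: subgroupM].
Qed.

Lemma conjugate_by_elementary g A : elementary A -> elementary (conjugate_by g A).
Proof.
move=> [sA [c Ac fin]]; split; first exact: conjugate_by_subgroup.
exists (c ^ g^-1); first by rewrite conjugate_byE conjgKV.
apply: sub_finite_set (finite_image (conjugate_by g) fin).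
move=> _ [x /conjugate_byE Ax <-].
exists (setmul [set x ^ g] (cyclic_span c)); first by exists (x ^ g).
apply/seteqP; split=> y; rewrite conjugate_byE.
  case/lcosetP => z [k cz] yz; exists x => //; exists (z ^ g^-1); last first.
    by apply: (conjg_inj g); rewrite conjMg conjgKV.
  by exists k; case: cz => ->; [left|right]; rewrite ?conjVg conjXg.
case/lcosetP => z [k cz] ->; exists (x ^ g) => //; exists (z ^ g);
  last by rewrite conjMg.
by exists k; case: cz => ->; [left|right]; rewrite ?conjVg conjXg conjgKV.
Qed.

Lemma conjugate_by_infinite g A : infinite_set A -> infinite_set (conjugate_by g A).
Proof.
move=> Ainf fin; apply: Ainf; rewrite -(conjugate_byK g A).
exact: finite_image fin.
Qed.

Lemma conjugate_by_maximal_elementary g A :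
  maximal_elementary A -> maximal_elementary (conjugate_by g A).
Proof.
move=> [eA maxA]; split; first exact: conjugate_by_elementary.
move=> E eE AE; rewrite -(conjugate_byKV g E) (maxA (conjugate_by g^-1 E)) //.
  exact: conjugate_by_elementary.
by rewrite -{1}(conjugate_byK g A); exact: conjugate_byS.
Qed.

End Conjugates.

(** * Products of subgroups *)

Section ProductsOfSubgroups.
Variable G : groupType.
Implicit Types (f e y u : G) (A B : set G) (Gs Hs : seq (set G)).

Definition maximal_elementary_infinite A : Prop :=
  maximal_elementary A /\ infinite_set A.

Fixpoint reduced Gs : Prop :=
  if Gs is A :: Gs' then
    [/\ maximal_elementary_infinite A,
        if Gs' is B :: _ then A <> B else True & reduced Gs']
  else True.

(* By local finiteness an injective sequence tends to infinity, and injectivity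
   passes to subsequences. *)
Fixpoint long_product Gs (x : nat -> G) : Prop :=
  if Gs is A :: Gs' then
    exists g t : nat -> G, [/\ injective g, forall k, A (g k), long_product Gs' t &
                    forall k, x k = g k * t k]
  else forall k, x k = 1.

(* [u] is the difference (e h_1 ... h_i)^-1 (f g_1 ... g_i) between the two
   paths after [i] steps, and [y] the final one. *)
Fixpoint matching u Gs Hs y : Prop :=
  match Gs, Hs with
  | [::], [::] => u = y
  | A :: Gs', B :: Hs' =>
      B = conjugate_by u A /\ exists2 w, B w & matching (w * u) Gs' Hs' y
  | _, _ => False
  end.

Lemma long_product_subsequence phi Gs x : injective phi ->
  long_product Gs x -> long_product Gs (x \o phi).
Proof.
move=> pinj; elim: Gs x => [|A Gs IHGs] x /=; first by move=> x1 k /=.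
move=> [g [t [ginj Ag lt xE]]]; exists (g \o phi), (t \o phi); split=> //=.
  exact: inj_comp.
exact: IHGs.
Qed.

Lemma reduced_cons A Gs : reduced (A :: Gs) -> reduced Gs.
Proof. by case. Qed.

Variables (len : G -> rat) (delta : rat).
Hypothesis hlen : hyperbolic_length len delta.
Local Notation gp := (gproduct len).

(** Here (x k | x k) is the length of [x k], which is unbounded. *)
Lemma infinite_intersection A B (x : nat -> G) :
  maximal_elementary_infinite A -> maximal_elementary_infinite B ->
  injective x -> (forall k, A (x k)) -> (forall k, B (x k)) -> A = B.
Proof.
move=> [Am Ai] [Bm Bi] xinj Ax Bx.
apply: (maximal_elementary_gproduct_unbounded hlen) => // N.
have [k Nk] := length_unbounded1 hlen xinj N.
exists (x k), (x k); split=> //.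
by rewrite /gproduct mulVg (length1 hlen); lra.
Qed.

Lemma distinct_gproduct_bounded A B :
  maximal_elementary_infinite A -> maximal_elementary_infinite B -> A <> B ->
  exists N, forall a b, A a -> B b -> (gp a b <= N)%R.
Proof.
move=> [Am Ai] [Bm Bi] AB; apply: contrapT => /forallNP nN; apply: AB.
apply: (maximal_elementary_gproduct_unbounded hlen) => // N.
apply: contrapT => noab; apply: (nN N) => a b Aa Bb.
by rewrite leNgt; apply/negP => Nab; apply: noab; exists a, b.
Qed.

(** The path does not backtrack at its first vertex. By induction (b | t y) = |b| - (b^-1 | s y)
    tends to infinity for the next factor [b], and (g^-1 | b) is bounded since neighbours differ;
    hyperbolicity then bounds (g^-1 | t y). *)
Lemma long_product_gproduct_bounded A Gs g t y :
  reduced (A :: Gs) -> injective g -> (forall k, A (g k)) -> long_product Gs t ->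
  exists C K, forall k, (K <= k)%N -> (gp (g k)^-1 (t k * y)%g <= C)%R.
Proof.
elim: Gs A g t => [|B Gs IHGs] A g t.
  move=> _ _ _ t1; exists (len y), 0%N => k _.
  by rewrite t1 mul1g; exact: gproduct_ler hlen _ _.
move=> [Am AB redB] ginj Ag [b [s [binj Bb ls tE]]].
have [C [K CK]] := IHGs B b s redB binj Bb ls.
have Bm : maximal_elementary_infinite B by case: redB.
have [N hN] := distinct_gproduct_bounded Am Bm AB; clear AB.
have [K' hK'] := length_unbounded hlen binj (N + delta + C)%R.
exists (N + delta)%R, (maxn K K') => k; rewrite geq_max => /andP[Kk K'k].
have := CK k Kk; have := hK' k K'k => bk sk.
have := gproduct_complement hlen (b k) (t k * y).
rewrite {2}tE -!mulgA mulKg => comp.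
have := hN _ _ (subgroupV (proj1 (proj1 (proj1 Am))) (Ag k)) (Bb k) => gb.
have := length_hyp hlen (g k)^-1 (t k * y) (b k).
by rewrite (gproductC hlen (t k * y) (b k)) => -[] ?; lra.
Qed.

Lemma long_product_length_unbounded A Gs x y : reduced (A :: Gs) ->
  long_product (A :: Gs) x -> forall r, exists k, (r < len (x k * y)%g)%R.
Proof.
move=> red [g [t [ginj Ag lt xE]]] r.
have [C [K CK]] := long_product_gproduct_bounded y red ginj Ag lt.
have [K' hK'] := length_unbounded hlen ginj (r + C)%R.
exists (maxn K K'); have := CK _ (leq_maxl K K'); have := hK' _ (leq_maxr K K').
have := gproduct_ler hlen (g (maxn K K'))^-1 (t (maxn K K') * y).
by rewrite xE -mulgA /gproduct invgK (lengthV hlen); lra.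
Qed.

Definition matched Gs Hs : Prop := forall f e y (s t : nat -> G),
  long_product Gs s -> long_product Hs t ->
  (forall k, f * s k = e * t k * y) -> matching (e^-1 * f) Gs Hs y.

(* If the first vertices [f * g k] and [e * h k] of the two paths drift apart,
   with the first one nearer to the origin, then both initial segments follow a
   common direction; so [A] is a conjugate of [B], and the first factor [g k]
   can be moved into [h k], producing a shorter relation that is impossible. *)
Lemma first_vertices_close A Gs B Hs f e y (g h s t : nat -> G) :
  reduced (A :: Gs) -> reduced (B :: Hs) -> matched Gs (B :: Hs) ->
  injective g -> (forall k, A (g k)) -> long_product Gs s ->
  (forall k, B (h k)) -> long_product Hs t -> injective h ->
  (forall k, f * (g k * s k) = e * (h k * t k) * y) ->
  injective (fun k => (f * g k)^-1 * (e * h k)) ->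
  (forall k, (len (f * g k)%g <= len (e * h k)%g)%R) -> False.
Proof.
move=> redA redB IH ginj Ag ls Bh lt hinj E vinj fe.
have [C [K CK]] := long_product_gproduct_bounded 1 redA ginj Ag ls.
have [D [L DL]] := long_product_gproduct_bounded y redB hinj Bh lt.
have Am : maximal_elementary_infinite A by case: redA.
have Bm : maximal_elementary_infinite B by case: redB.
set u := f^-1 * e.
have AB : A = conjugate_by u B.
  apply: (maximal_elementary_gproduct_unbounded hlen); try by case: Am.
  - exact: conjugate_by_maximal_elementary (proj1 Bm).
  - exact: conjugate_by_infinite (proj2 Bm).
  move=> N; have [M hM] := length_unbounded hlen ginj
    (`|N| + `|C| + `|D| + 2%:R * len f + len e + delta + len f + len u)%R.
  pose k := maxn M (maxn K L).
  have kM : (M <= k)%N by exact: leq_maxl.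
  have kK : (K <= k)%N by rewrite /k !leq_max leqnn orbT.
  have kL : (L <= k)%N by rewrite /k !leq_max leqnn !orbT.
  exists (g k), (h k ^ u^-1); split=> //; first by rewrite conjugate_byE conjgKV.
  have d0 := delta_ge0 hlen; have f0 := length_ge0 hlen f.
  have e0 := length_ge0 hlen e.
  have gk := hM k kM; have sk := CK k kK; have tk := DL k kL.
  have := ler_norm C; have := ler_norm D; have := ler_norm N.
  have := normr_ge0 C; have := normr_ge0 D; have := normr_ge0 N.
  (* Both paths end at [x]. By [px] and [qx] both first vertices nearly lie on [1, x], so their
     product [pq] is almost the smaller length, that of [f * g k]. *)
  set x := f * (g k * s k).
  have px : (len (f * g k)%g - `|C| - len f <= gp (f * g k)%g x)%R.
    have := gproduct_complement hlen (f * g k) x.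
    have -> : (f * g k)^-1 * x = s k by rewrite /x !gnorm.
    have := gproductMl hlen (g k)^-1 (s k) f^-1.
    rewrite ler_distl invgM (lengthV hlen) => /andP[_].
    by move: sk; rewrite mulg1; have := ler_norm C; lra.
  have qx : (len (e * h k)%g - `|D| - len e <= gp (e * h k)%g x)%R.
    have := gproduct_complement hlen (e * h k) x.
    have -> : (e * h k)^-1 * x = t k * y by rewrite /x E !gnorm.
    have := gproductMl hlen (h k)^-1 (t k * y) e^-1.
    rewrite ler_distl invgM (lengthV hlen) => /andP[_].
    by have := ler_norm D; lra.
  have pq : (len (f * g k)%g - `|C| - `|D| - len f - len e - delta <=
      gp (f * g k)%g (e * h k)%g)%R.
    have := length_hyp hlen (f * g k) x (e * h k); have := fe k.
    have := normr_ge0 C; have := normr_ge0 D.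
    by rewrite (gproductC hlen x (e * h k)) => ? ? ? -[] ?; lra.
  have := lengthM hlen f^-1 (f * g k); rewrite mulKg (lengthV hlen).
  have := gproductMMl hlen f (g k) (u * h k).
  have -> : f * (u * h k) = e * h k by rewrite /u !gnorm.
  have := gproductMr hlen (g k) (h k ^ u^-1) u; rewrite ler_distl => /andP[_].
  have -> : h k ^ u^-1 * u = u * h k by rewrite conjgE !gnorm.
  by have := ler_norm N; have := normr_ge0 N; lra.
(* Cancelling [f * g k] leaves [s k = u * (b k * t k) * y], where [b k] is in [B] and is injective
   because the gap between the vertices is. *)
pose b k := u^-1 * (g k)^-1 * u * h k.
have Bb k : B (b k).
  have : conjugate_by u B (g k)^-1.
    by rewrite -AB; apply: subgroupV (Ag k); case: Am => -[[]].
  rewrite conjugate_byE conjgE mulgA => Bg.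
  by apply: subgroupM Bg (Bh k); case: Bm => -[[]].
have bE k : b k = u^-1 * ((f * g k)^-1 * (e * h k)) by rewrite /b /u !gnorm.
have binj : injective b by move=> i j; rewrite !bE => /mulgI /vinj.
have := IH 1 u y s (fun k => b k * t k) ls.
(* An empty [Gs] cannot match [B :: Hs]; otherwise the matching makes [A'] equal to its neighbour
   [A]. *)
case: Gs redA {IH ls CK} => [|A' Gs] redA.
  case=> //; first by exists b, t.
  move=> k; rewrite mul1g /b; apply: (mulgI (f * g k)).
  by rewrite -[LHS]mulgA E /u !gnorm.
case=> [||BA' _]; first by exists b, t.
  move=> k; rewrite mul1g /b; apply: (mulgI (f * g k)).
  by rewrite -[LHS]mulgA E /u !gnorm.
case: redA => _ AA' _; apply: AA'.
by rewrite AB BA' mulg1 conjugate_byKV.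
Qed.

(** Along a subsequence the gap between the first vertices is constant or injective. A constant gap
    identifies the first subgroups and starts the remaining relation; an injective one is excluded
    by [first_vertices_close], applied to the paths in the appropriate order. *)
Lemma long_products_matched n Gs Hs : (size Gs + size Hs <= n)%N ->
  reduced Gs -> reduced Hs -> matched Gs Hs.
Proof.
elim: n Gs Hs => [|n IHn] [|A Gs] [|B Hs] //= sz redA redB f e y s t.
- by move=> s1 t1 E; have := E 0%N; rewrite s1 t1 !mulg1 => ->; rewrite mulKg.
- by move=> s1 t1 E; have := E 0%N; rewrite s1 t1 !mulg1 => ->; rewrite mulKg.
- move=> s1 lt E; have [k] := long_product_length_unbounded y redB lt (len (e^-1 * f)).
  by have := E k; rewrite s1 mulg1 => ->; rewrite !gnorm ltxx.
- move=> ls t1 E.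
  have [k] := long_product_length_unbounded 1 redA ls (len (f^-1 * e * y)).
  have -> : s k * 1 = f^-1 * e * y.
    by have := E k; rewrite t1 mulg1 mulg1 -mulgA => <-; rewrite mulKg.
  by rewrite ltxx.
move=> [g [s' [ginj Ag ls sE]]] [h [t' [hinj Bh lt tE]]] E.
have E' k : f * (g k * s' k) = e * (h k * t' k) * y by rewrite -sE -tE.
have redGs := reduced_cons redA; have redHs := reduced_cons redB.
rewrite addSn addnS ltnS in sz.
have [phi pinj [[v vE]|vinj]] :=
    subsequence_dichotomy (fun k => (f * g k)^-1 * (e * h k)).
  have Am : maximal_elementary_infinite A by case: redA.
  have Bm : maximal_elementary_infinite B by case: redB.
  have sA : subgroup A by case: Am => -[[]].
  have sB : subgroup B by case: Bm => -[[]].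
  have hE k : h (phi k) = (e^-1 * f) * g (phi k) * v by rewrite -(vE k) !gnorm.
  (* In the quotients [h (phi k) * (h (phi 0))^-1] the gap [v] cancels, so they lie in both
     subgroups. *)
  have BE : B = conjugate_by (e^-1 * f) A.
    apply: (@infinite_intersection _ _ (fun k => h (phi k) * (h (phi 0%N))^-1)) => //.
    - split; first exact: conjugate_by_maximal_elementary (proj1 Am).
      exact: conjugate_by_infinite (proj2 Am).
    - by move=> i j /mulIg /hinj /pinj.
    - by move=> k; apply: (proj2 sB).
    - move=> k; rewrite conjugate_byE.
      have -> : (h (phi k) * (h (phi 0%N))^-1) ^ (e^-1 * f) =
          g (phi k) * (g (phi 0%N))^-1 by rewrite !hE conjgE !gnorm.
      exact: (proj2 sA).
  (* Multiplied by [e^-1 * f] this is [v^-1], the difference of the paths after one step. *)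
  split=> //; exists (v^-1 * (e^-1 * f)^-1).
    have -> : v^-1 * (e^-1 * f)^-1 =
        (h (phi 0%N))^-1 * ((e^-1 * f) * g (phi 0%N) * (e^-1 * f)^-1).
      by rewrite hE !gnorm.
    apply: subgroupM => //; first exact: subgroupV.
    rewrite {1}BE conjugate_byE.
    have -> // : (e^-1 * f * g (phi 0%N) * (e^-1 * f)^-1) ^ (e^-1 * f) = g (phi 0%N).
    by rewrite conjgE !gnorm.
  have := IHn Gs Hs _ redGs redHs 1 v y (s' \o phi) (t' \o phi).
  rewrite mulgVK mulg1; apply.
  - exact: ltnW.
  - exact: long_product_subsequence.
  - exact: long_product_subsequence.
  move=> k /=; rewrite mul1g -(vE k); apply: (mulgI (f * g (phi k))).
  by rewrite -[LHS]mulgA E' !gnorm.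
have [psi qinj fe] : exists2 psi : nat -> nat, injective psi &
    (forall k, (len (f * g (phi (psi k)))%g <= len (e * h (phi (psi k)))%g)%R) \/
    (forall k, (len (e * h (phi (psi k)))%g <= len (f * g (phi (psi k)))%g)%R).
  apply: (@subsequence_or
    (fun k => (len (f * g (phi k))%g <= len (e * h (phi k))%g)%R)
    (fun k => (len (e * h (phi k))%g <= len (f * g (phi k))%g)%R)) => k.
  by apply/orP; exact: le_total.
have chi_inj : injective (phi \o psi) by exact: inj_comp.
exfalso; case: fe => fe.
  apply: (@first_vertices_close A Gs B Hs f e y (g \o (phi \o psi))
    (h \o (phi \o psi)) (s' \o (phi \o psi)) (t' \o (phi \o psi))) => //=.
  - by apply: IHn => //; rewrite /= addnS.
  - exact: inj_comp.
  - exact: long_product_subsequence.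
  - exact: long_product_subsequence.
  - exact: inj_comp.
  - exact: inj_comp vinj qinj.
(* Exchanging the two paths replaces [y] by [y^-1]. *)
apply: (@first_vertices_close B Hs A Gs e f y^-1 (h \o (phi \o psi))
    (g \o (phi \o psi)) (t' \o (phi \o psi)) (s' \o (phi \o psi))) => //=.
- by apply: IHn => //; rewrite /= addnS addnC.
- exact: inj_comp.
- exact: long_product_subsequence.
- exact: long_product_subsequence.
- exact: inj_comp.
- by move=> k; rewrite E' mulgK.
move=> i j eij; apply/qinj/vinj => /=; apply: invg_inj.
by rewrite !invgM !invgK in eij *.
Qed.

End ProductsOfSubgroups.

(** * Absorbing bounded factors of a product *)

Section BoundedOrLong.
Variable G : groupType.
Implicit Types (e f y u : G) (A B : set G) (Gs Hs : seq (set G)).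

Definition set_product Gs : set G := \big[@setmul G/[set 1]]_(A <- Gs) A.

Lemma set_product_cons A Gs x : set_product (A :: Gs) x <->
  exists g t, [/\ A g, set_product Gs t & x = g * t].
Proof.
rewrite /set_product big_cons; split=> [[g Ag [t Gt <-]]|[g [t [Ag Gt ->]]]].
  by exists g, t.
by exists g => //; exists t.
Qed.

Lemma set_product_nil x : set_product [::] x <-> x = 1.
Proof. by rewrite /set_product big_nil. Qed.

Lemma conjugate_by1 A : conjugate_by 1 A = A.
Proof. by apply/seteqP; split=> x; rewrite conjugate_byE conjg1. Qed.

(** Induction on the factors: a new first factor that is constant on a subsequence goes into [e]; an
    injective one is kept, or merged with an equal neighbour. Every absorption or merger lowers the
    number of factors. *)
Lemma bounded_or_long_product Hs (x : nat -> G) : reduced Hs ->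
  (forall k, set_product Hs (x k)) ->
  exists phi Hs' e y t,
    [/\ injective phi, reduced Hs', long_product Hs' t,
        forall k, x (phi k) = e * t k * y &
        (size Hs' < size Hs)%N \/ [/\ Hs' = Hs, e = 1 & y = 1]].
Proof.
elim: Hs x => [|H Hs IHHs] x redH xH.
  exists id, [::], 1, 1, (fun=> 1); split=> // [k|]; last by right.
  by have /set_product_nil -> := xH k; rewrite !mulg1.
have /choice [hw hwE] : forall k, exists p : G * G,
    [/\ H p.1, set_product Hs p.2 & x k = p.1 * p.2].
  by move=> k; have /set_product_cons [g [t [? ? ?]]] := xH k; exists (g, t).
have [k|phi [Hs' [e [y [t [pinj redHs' lt wE sz]]]]]] :=
    IHHs (fun k => (hw k).2) (reduced_cons redH).
  by case: (hwE k).
have sz' : (size Hs' <= size Hs)%N.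
  by case: sz => [/ltnW|[->]].
have xE k : x (phi k) = (hw (phi k)).1 * (e * t k * y).
  by case: (hwE (phi k)) => _ _ ->; rewrite -wE.
have Hh k : H (hw k).1 by case: (hwE k).
have [psi qinj [[v vE]|hinj]] := subsequence_dichotomy (fun k => (hw (phi k)).1).
  exists (phi \o psi), Hs', (v * e), y, (t \o psi); split=> //=.
  - exact: inj_comp.
  - exact: long_product_subsequence.
  - by move=> k; rewrite xE vE !mulgA.
  by left; rewrite ltnS.
(* By h e = e (h ^ e), the new factor moves to the right of [e] as an element of [H']. *)
pose H' := conjugate_by e^-1 H.
have Hm : maximal_elementary_infinite H by case: redH.
have Hm' : maximal_elementary_infinite H'.
  split; first exact: conjugate_by_maximal_elementary (proj1 Hm).
  exact: conjugate_by_infinite (proj2 Hm).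
pose h' k := (hw (phi (psi k))).1 ^ e.
have Hh' k : H' (h' k) by rewrite /H' conjugate_byE conjgK.
have h'inj : injective h' by move=> i j /conjg_inj /hinj.
have xE' k : x (phi (psi k)) = e * (h' k * t (psi k)) * y.
  by rewrite xE /h' conjgE !gnorm.
have head_distinct : (if Hs' is B :: _ then H' <> B else True) ->
    exists phi Hs' e y t,
    [/\ injective phi, reduced Hs', long_product Hs' t,
        forall k, x (phi k) = e * t k * y &
        (size Hs' < size (H :: Hs))%N \/ [/\ Hs' = H :: Hs, e = 1 & y = 1]].
  move=> HB; exists (phi \o psi), (H' :: Hs'), e, y, (fun k => h' k * t (psi k)).
  split=> //; first exact: inj_comp.
    by exists h', (t \o psi); split=> //; exact: long_product_subsequence.
  case: sz => [lt_sz|[eHs e1 y1]]; [by left | right].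
  by rewrite /H' eHs e1 y1 invg1 conjugate_by1.
case: Hs' redHs' lt sz sz' head_distinct => [|B Hs'] redB lt sz sz'; first exact.
have [H'B _|HB] := pselect (H' = B); last by apply.
have [b [t' [binj Bb lt' tE]]] := lt.
have sB : subgroup B by case: redB => -[[[]]].
(* The merged factor in [B] may itself have become constant, and is then absorbed too. *)
have [chi rinj [[v vE]|sinj]] := subsequence_dichotomy (fun k => h' k * b (psi k)).
  exists (phi \o (psi \o chi)), Hs', (e * v), y, (t' \o (psi \o chi)); split=> //=.
  - by do 2?apply: inj_comp.
  - exact: reduced_cons redB.
  - by apply: long_product_subsequence => //; exact: inj_comp.
  - by move=> k; rewrite xE' tE -(vE k) !mulgA.
  by left; rewrite ltnS ltnW.
exists (phi \o (psi \o chi)), (B :: Hs'), e, y,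
  (fun k => h' (chi k) * b (psi (chi k)) * t' (psi (chi k))).
split=> //; last by left; rewrite ltnS.
- by do 2?apply: inj_comp.
- exists (fun k => h' (chi k) * b (psi (chi k))), (t' \o (psi \o chi)); split=> //.
    by move=> k; apply: subgroupM => //; rewrite -H'B.
  by apply: long_product_subsequence => //; exact: inj_comp.
by move=> k; rewrite /= xE' tE !mulgA.
Qed.

Lemma exists_long_product Gs : reduced Gs ->
  exists2 s, long_product Gs s & forall k, set_product Gs (s k).
Proof.
elim: Gs => [|A Gs IHGs] redA.
  by exists (fun=> 1) => // k; exact/set_product_nil.
have [t lt Gt] := IHGs (reduced_cons redA).
have [g ginj Ag] : exists2 g : nat -> G, injective g & forall k, A (g k).
  by case: redA => -[_ /infinite_injection].
exists (fun k => g k * t k); first by exists g, t.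
by move=> k; apply/set_product_cons; exists (g k), (t k).
Qed.

Lemma matching_size u Gs Hs y : matching u Gs Hs y -> size Gs = size Hs.
Proof.
by elim: Gs u Hs => [|A Gs IHGs] u [|B Hs] //= [_ [w _ /IHGs ->]].
Qed.

(** In terms of subsets, u A_1 ... A_n = B_1 ... B_n y: each step uses u A = B u = B w u, valid for
    [w] in [B]. *)
Lemma matching_set_product u Gs Hs y x : reduced Hs -> matching u Gs Hs y ->
  set_product Gs (u^-1 * x) <-> set_product Hs (x * y^-1).
Proof.
elim: Gs u Hs x => [|A Gs IHGs] u [|B Hs] //= x redB.
  move=> ->; rewrite !set_product_nil; split=> E.
    by rewrite -(mulVKg y x) E mulg1 mulgV.
  by rewrite -(mulgVK y x) E mul1g mulVg.
move=> [BA [w Bw wM]]; have IH := IHGs _ _ _ (reduced_cons redB) wM.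
have sB : subgroup B by case: redB => -[[[]]].
rewrite !set_product_cons; split=> -[g [t [Ag Gt E]]].
  exists (u * g * u^-1 * w^-1), (w * u * t * y^-1); split.
  - apply: subgroupM => //; last exact: subgroupV.
    by rewrite BA conjugate_byE conjgE !gnorm.
  - by apply/IH; rewrite !gnorm.
  by move/(congr1 (fun z => u * z * y^-1)): E; rewrite !gnorm.
exists (u^-1 * (g * w) * u), (u^-1 * w^-1 * t * y); split.
- have : B (g * w) by exact: subgroupM.
  by rewrite BA conjugate_byE conjgE mulgA.
- have := IH (t * y); rewrite !gnorm => -[_]; exact.
by move/(congr1 (fun z => u^-1 * z * y)): E; rewrite !gnorm.
Qed.

End BoundedOrLong.

(** * Word length *)

Section WordLength.
Variables (G : groupType) (S : seq G) (genS : generates S).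
Implicit Types x y : G.

Lemma spelledP x n : reflect (exists w : seq G,
    [/\ all (fun s => (s \in S) || (s^-1 \in S)) w, \prod_(s <- w) s = x & size w = n])
  (spelled S x n).
Proof. exact: asboolP. Qed.

Lemma spelledM x y m n : spelled S x m -> spelled S y n -> spelled S (x * y) (m + n).
Proof.
move=> /spelledP [v [Sv vx sv]] /spelledP [w [Sw wy sw]].
apply/spelledP; exists (v ++ w).
by rewrite all_cat Sv Sw big_cat size_cat sv sw /= vx wy.
Qed.

Lemma spelledV x n : spelled S x n -> spelled S x^-1 n.
Proof.
move=> /spelledP [w [Sw <- sw]]; apply/spelledP.
exists (rev [seq s^-1 | s <- w]); split; last by rewrite size_rev size_map.
  rewrite all_rev all_map; apply: sub_all Sw => s /=.
  by rewrite invgK orbC.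
elim: w {Sw sw} => [|s w IHw]; first by rewrite !big_nil invg1.
by rewrite /= rev_cons -cats1 big_cat IHw big_seq1 big_cons invgM.
Qed.

Lemma word_length_spelled x : spelled S x (word_length genS x).
Proof. by rewrite /word_length; case: ex_minnP. Qed.

Lemma word_length_le x n : spelled S x n -> (word_length genS x <= n)%N.
Proof. by rewrite /word_length; case: ex_minnP => m _ mmin /mmin. Qed.

Lemma finite_spelled n : finite_set [set x | spelled S x n].
Proof.
elim: n => [|n IHn].
  apply: sub_finite_set (finite_set1 (1 : G)) => x /spelledP [w [_ <-]].
  by move/size0nil => ->; rewrite big_nil.
have Sfin : finite_set [set` S ++ [seq s^-1 | s <- S]] by exact: finite_seq.
apply: sub_finite_set (finite_image2 (fun x y : G => x * y) Sfin IHn).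
move=> x /spelledP [[|s w] [Sw <- sw]] //.
move: Sw => /= /andP[Ss Sw]; exists s.
  rewrite /= mem_cat; case/orP: Ss => [->//|sV]; apply/orP; right.
  by apply/mapP; exists s^-1 => //; rewrite invgK.
exists (\prod_(s <- w) s); last by rewrite big_cons.
by apply/spelledP; exists w; split=> //; case: sw.
Qed.

(** Balls are finite because the generating set is, and a midpoint is the first half of a shortest
    word. *)
Lemma word_length_hyperbolic (delta : rat) :
  (forall w x y z : G,
     (Num.min (gromov_product genS w x y) (gromov_product genS w y z) - delta
         <= gromov_product genS w x z)%R) ->
  hyperbolic_length (fun x => (word_length genS x)%:R)%R delta.
Proof.
move=> hyp.
have lV x : word_length genS x^-1 = word_length genS x.
  have le y : (word_length genS y^-1 <= word_length genS y)%N.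
    by apply/word_length_le/spelledV/word_length_spelled.
  by apply/eqP; rewrite eqn_leq le -{1}(invgK x) le.
have lM x y : (word_length genS (x * y) <= word_length genS x + word_length genS y)%N.
  by apply/word_length_le/spelledM; exact: word_length_spelled.
split=> [|x|x y|r|x|x y z].
- apply/eqP; rewrite pnatr_eq0 -leqn0; apply: word_length_le.
  by apply/spelledP; exists [::]; rewrite big_nil.
- by rewrite lV.
- by rewrite -natrD ler_nat lM.
- have [N rN] : exists N : nat, (r <= N%:R)%R.
    exists (Num.bound `|r|%R); apply: le_trans (ler_norm r) _.
    by apply/ltW/archi_boundP/normr_ge0.
  apply: sub_finite_set (@bigcup_finite _ _ `I_N.+1 _ (finite_II _)
    (fun n _ => finite_spelled n)).
  move=> x xr; exists (word_length genS x); last exact: word_length_spelled.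
  by rewrite /= ltnS -(ler_nat rat); exact: le_trans rN.
- have /spelledP [w [Sw wx sw]] := word_length_spelled x.
  set n := word_length genS x in sw *.
  have [k kn] : exists k, (k.*2 <= n <= k.*2.+1)%N.
    exists n./2; rewrite -{2 3}(odd_double_half n).
    by case: (odd n); rewrite /= ?leqnn ?leqnSn.
  set m := \prod_(s <- take k w) s.
  have mx : m^-1 * x = \prod_(s <- drop k w) s.
    by rewrite -wx -{1}(cat_take_drop k w) big_cat /= mulKg.
  have km : (word_length genS m <= k)%N.
    apply/word_length_le/spelledP; exists (take k w); split=> //.
      by apply/allP => s /mem_take; exact: (allP Sw).
    by rewrite size_takel // sw; lia.
  have kmx : (word_length genS (m^-1 * x) <= n - k)%N.
    apply/word_length_le/spelledP; exists (drop k w); split=> //.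
      by apply/allP => s /mem_drop; exact: (allP Sw).
    by rewrite size_drop sw.
  have nle := lM m (m^-1 * x); rewrite mulVKg -/n in nle.
  (* The two halves have lengths at most [k] and [n - k] with sum at least [n], so both bounds are
     attained. *)
  have mk : word_length genS m = k by lia.
  have mxk : word_length genS (m^-1 * x) = (n - k)%N by lia.
  exists m; rewrite mk mxk.
  case/andP: kn => k1 k2.
  have : ((k.*2)%:R <= n%:R :> rat)%R by rewrite ler_nat.
  have : (n%:R <= (k.*2.+1)%:R :> rat)%R by rewrite ler_nat.
  rewrite -natr1 -addnn natrD => n2 n1.
  split; [by rewrite -natrD subnKC // (leq_trans _ k1) // -addnn leq_addr | lra | lra].
have := hyp 1 x y z; rewrite /gromov_product /gproduct /word_dist !mulg1 !lV.
by rewrite minElt; case: ifP => _ ?; [left|right].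
Qed.

End WordLength.

(** * Families indexed by integers *)

Section IndexedFamilies.
Variable G : groupType.
Implicit Types (u y f e : G) (A B : nat -> set G) (z : nat -> G).

Lemma reduced_map A i l :
  (forall j, (i <= j < i + l)%N -> maximal_elementary_infinite (A j)) ->
  (forall j, (i <= j)%N -> (j.+1 < i + l)%N -> A j <> A j.+1) ->
  reduced [seq A j | j <- iota i l].
Proof.
elim: l i => [|l IHl] i //= Am Ad; split.
- by apply: Am; rewrite leqnn addnS ltnS leq_addr.
- case: l {IHl} Ad Am => //= l Ad _; apply: Ad => //.
  by rewrite !addnS !ltnS leq_addr.
apply: IHl => j; first by move=> /andP[ij jl]; apply: Am; rewrite ltnW // addnS -addSn.
by move=> ij jl; apply: Ad; rewrite ?addnS -?addSn // ltnW.
Qed.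

Lemma translated_productP f A n x : translated_product f A n x <->
  set_product [seq A j | j <- iota 1 n] (f^-1 * x).
Proof.
rewrite /translated_product /set_product big_map /index_iota subn1 /=.
split=> [[_ -> [w Aw <-]]|Aw]; first by rewrite mulKg.
by exists f => //; exists (f^-1 * x) => //; rewrite mulVKg.
Qed.

Lemma descending_product_last z n : descending_product z n n = 1.
Proof. by rewrite /descending_product /index_iota subnn big_nil. Qed.

Lemma descending_product_step z n j : (j < n)%N ->
  descending_product z n j = descending_product z n j.+1 * z j.+1.
Proof.
move=> jn; rewrite /descending_product /index_iota subSS.
rewrite -[(n - j)%N](subnSK jn) /= rev_cons -cats1 big_cat big_seq1.
by rewrite subSS.
Qed.

(** The [w] of each step becomes [z j]. The difference before step [j] is the inverse of z_n ... z_j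
    times [y], and [z j] drops out of the conjugation because it normalizes [B j]. *)
Lemma matching_indexed u y A B n i : (i <= n)%N ->
  (forall j, (i < j <= n)%N -> subgroup (B j)) ->
  matching u [seq A j | j <- iota i.+1 (n - i)] [seq B j | j <- iota i.+1 (n - i)] y <->
  exists z, [/\ forall j, (i < j <= n)%N -> B j (z j),
    forall j, (i < j <= n)%N ->
      A j = conjugate_by (y^-1 * descending_product z n j) (B j) &
    y = descending_product z n i * u].
Proof.
move=> i_n; have [l def_l] : exists l, (n - i)%N = l by exists (n - i)%N.
rewrite def_l; elim: l i i_n def_l u => [|l IHl] i i_n def_l u sB /=.
  have -> : i = n by lia.
  split=> [<-|[z [_ _ ->]]]; last by rewrite descending_product_last mul1g.
  exists (fun=> 1); split=> [j|j|]; [lia | lia | ].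
  by rewrite descending_product_last mul1g.
have i_lt_n : (i < n)%N by lia.
have sB' j : (i.+1 < j <= n)%N -> subgroup (B j) by move=> ?; apply: sB; lia.
have sBi : subgroup (B i.+1) by apply: sB; lia.
have def_l' : (n - i.+1)%N = l by lia.
have IH v := IHl i.+1 i_lt_n def_l' v sB'.
split=> [[BA [w Bw /IH [z [Bz Az yz]]]]|[z [Bz Az yz]]].
  pose z' j := if j == i.+1 then w else z j.
  have zz' j : (i < j)%N -> descending_product z' n j = descending_product z n j.
    move=> ij; rewrite /descending_product; apply: eq_big_seq => k.
    by rewrite mem_rev mem_index_iota /z' => ?; case: eqP => // ?; lia.
  exists z'; split=> [j jn|j jn|].
  - by rewrite /z'; case: eqP => [->//|?]; apply: Bz; lia.
  - rewrite zz'; last lia.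
    have [->|ji] := eqVneq j i.+1; last by apply: Az; lia.
    have -> : y^-1 * descending_product z n i.+1 = u^-1 * w^-1.
      by rewrite yz !gnorm.
    by rewrite -conjugate_byM (conjugate_by_id sBi (subgroupV sBi Bw)) BA conjugate_byK.
  by rewrite descending_product_step // zz' // /z' eqxx yz mulgA.
have yz' : y = descending_product z n i.+1 * (z i.+1 * u).
  by rewrite yz descending_product_step // mulgA.
split.
  rewrite (Az i.+1); last lia.
  have -> : y^-1 * descending_product z n i.+1 = u^-1 * (z i.+1)^-1.
    by rewrite yz' !gnorm.
  have Bzi : B i.+1 (z i.+1) by apply: Bz; lia.
  by rewrite -conjugate_byM (conjugate_by_id sBi (subgroupV sBi Bzi)) conjugate_byKV.
exists (z i.+1); first by apply: Bz; lia.
by apply/IH; exists z; split=> // j jn; [apply: Bz | apply: Az]; lia.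
Qed.

Variables (len : G -> rat) (delta : rat).
Hypothesis hlen : hyperbolic_length len delta.

(** A long product over [Gs] is also a product over [Hs]; what is left of it after absorption
    matches [Gs]. Equal sizes mean that nothing was absorbed, so the matching ends at 1. *)
Lemma set_product_size f e (Gs Hs : seq (set G)) : reduced Gs -> reduced Hs ->
  (forall x, set_product Gs (f^-1 * x) -> set_product Hs (e^-1 * x)) ->
  (size Gs <= size Hs)%N /\
  (size Gs = size Hs -> matching (e^-1 * f) Gs Hs 1).
Proof.
move=> redG redH sub.
have [s ls Gs_s] := exists_long_product redG.
have [k|phi [Hs' [e' [y [t [pinj redH' lt E sz]]]]]] :=
    @bounded_or_long_product _ Hs (fun k => e^-1 * (f * s k)) redH.
  by apply: sub; rewrite mulKg.
have M : matching (e'^-1 * (e^-1 * f)) Gs Hs' y.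
  apply: (long_products_matched hlen (leqnn _) redG redH'
    (long_product_subsequence pinj ls) lt) => k /=.
  by rewrite -E mulgA.
have szG := matching_size M.
case: sz => [lt_sz|[eH e1 y1]].
  split; first by rewrite szG ltnW.
  by move=> eGH; move: lt_sz; rewrite -szG eGH ltnn.
split; first by rewrite szG eH.
by move=> _; move: M; rewrite eH e1 y1 invg1 mul1g.
Qed.

End IndexedFamilies.

(** * Equality of two translated products *)

Theorem theorem2 (G : groupType) (hG : hyperbolic G)
    (n m : nat) (n_ge1 : (1 <= n)%N) (m_ge1 : (1 <= m)%N)
    (GG HH : nat -> set G) (f e : G)
    (hGG : forall i : nat, (1 <= i <= n)%N ->
       maximal_elementary (GG i) /\ infinite_set (GG i))
    (hHH : forall j : nat, (1 <= j <= m)%N ->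
       maximal_elementary (HH j) /\ infinite_set (HH j))
    (neqG : forall i : nat, (1 <= i < n)%N -> GG i <> GG i.+1)
    (neqH : forall j : nat, (1 <= j < m)%N -> HH j <> HH j.+1) :
  translated_product f GG n = translated_product e HH m <->
  [/\ n = m,
      GG n = HH n &
      exists z : nat -> G,
        [/\ forall j : nat, (1 <= j <= n)%N -> HH j (z j),
            forall j : nat, (1 <= j < n)%N ->
              GG j = conjugate_by (descending_product z n j) (HH j) &
            f = (e * \prod_(1 <= j < n.+1) (z j)^-1)%g]].
Proof.
have [S [genS [delta hyp]]] := hG.
have hlen := word_length_hyperbolic hyp.
have redG : reduced [seq GG j | j <- iota 1 n].
  apply: reduced_map => j; first by rewrite add1n ltnS; exact: hGG.
  by rewrite add1n ltnS => j1 jn; apply: neqG; rewrite j1.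
have redH : reduced [seq HH j | j <- iota 1 m].
  apply: reduced_map => j; first by rewrite add1n ltnS; exact: hHH.
  by rewrite add1n ltnS => j1 jm; apply: neqH; rewrite j1.
have sH j : (0 < j <= m)%N -> subgroup (HH j) by move=> /hHH [[[]]].
have prodV z : \prod_(1 <= j < n.+1) (z j)^-1 = (descending_product z n 0)^-1.
  by rewrite /descending_product prodgV.
split=> [eGH|[nm GHn [z [Hz Gz fz]]]].
  have subGH x : set_product [seq GG j | j <- iota 1 n] (f^-1 * x) ->
      set_product [seq HH j | j <- iota 1 m] (e^-1 * x).
    by move=> ?; apply/translated_productP; rewrite -eGH; apply/translated_productP.
  have subHG x : set_product [seq HH j | j <- iota 1 m] (e^-1 * x) ->
      set_product [seq GG j | j <- iota 1 n] (f^-1 * x).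
    by move=> ?; apply/translated_productP; rewrite eGH; apply/translated_productP.
  have [nm M] := set_product_size hlen redG redH subGH.
  have [mn _] := set_product_size hlen redH redG subHG.
  rewrite !size_map !size_iota in nm mn M.
  have {nm mn} nm : n = m by apply/eqP; rewrite eqn_leq nm mn.
  move: M => /(_ nm); subst m.
  have := @matching_indexed _ (e^-1 * f) 1 GG HH n 0 (leq0n n) sH.
  rewrite subn0 => -[+ _] M => /(_ M) [z [Hz Gz zu]].
  (* As the final difference is 1, the conjugators are the descending products; the empty one, at
     [j = n], gives [GG n = HH n]. *)
  have Gz' j : (0 < j <= n)%N -> GG j = conjugate_by (descending_product z n j) (HH j).
    by move=> /Gz; rewrite invg1 mul1g.
  split=> //.
    by rewrite Gz' ?n_ge1 ?leqnn // descending_product_last conjugate_by1.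
  exists z; split=> // [j /andP[j1 jn]|].
    by apply: Gz'; rewrite j1 ltnW.
  rewrite prodV; apply: (mulgI e^-1); apply: (mulgI (descending_product z n 0)).
  by rewrite -zu !gnorm.
subst m; have M : matching (e^-1 * f)
  [seq GG j | j <- iota 1 n] [seq HH j | j <- iota 1 n] 1.
  have := @matching_indexed _ (e^-1 * f) 1 GG HH n 0 (leq0n n) sH.
  rewrite subn0 => -[_]; apply; exists z; split=> // [j /andP[j1]|].
    rewrite leq_eqVlt invg1 mul1g => /orP[/eqP ->|jn].
      by rewrite descending_product_last conjugate_by1.
    by apply: Gz; rewrite j1.
  by rewrite fz prodV !gnorm.
apply/seteqP; split=> x /translated_productP Px; apply/translated_productP.
  have := matching_set_product (e^-1 * x) redH M.
  by rewrite invg1 mulg1 => <-; rewrite invgM invgK !gnorm.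
have := matching_set_product (e^-1 * x) redH M; rewrite invg1 mulg1 => -[_ /(_ Px)].
by rewrite !gnorm.
Qed.
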